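(* Let $x(t)=\sum_{k=1}^K A_k(t)e^{i2\pi\phi_k(t)}\in\mathcal{E}_{\epsilon_1,\epsilon_3}$ for some $\epsilon_1>0,\epsilon_3>0$, and let $U_x(a,b,\lambda)$ be the adaptive time-scale-chirp_rate transform (TSC-R) of $x$ with a window function $g$. Suppose that for some $0<\Delta<1$ and $\Delta_1>0$, for any $k\neq \ell$, either $$\frac{|\phi_k'(t)-\phi_\ell'(t)|}{\phi_k'(t)+\phi_\ell'(t)}\ge\Delta \ \text{ for all } t\in\mathbb{R},\qquad\text{or}\qquad |\phi_k''(t)-\phi_\ell''(t)|\ge 2\Delta_1\ \text{ for all } t\in\mathbb{R},$$ and that $$2M(b)\big(\Upsilon(b)+\Pi_0(b)\big)\le \nu(b),\qquad b\in\mathbb{R}.$$ Let $\mathcal{H}_b$ and $\mathcal{H}_{b,k}$ be the sets defined in the context with a function $\widetilde\epsilon_1=\widetilde\epsilon_1(b)>0$ satisfying $$M(b)\big(\Upsilon(b)+\Pi_0(b)\big)\le\widetilde\epsilon_1\le \nu(b)-M(b)\big(\Upsilon(b)+\Pi_0(b)\big).$$ Then for each $b\in\mathbb{R}$: (a) $\mathcal{H}_b=\bigcup_{k=1}^K\mathcal{H}_{b,k}$. (b) The sets $\mathcal{H}_{b,k}$, $1\le k\le K$, are disjoint, i.e. $\mathcal{H}_{b,k}\cap\mathcal{H}_{b,k'}=\emptyset$ if $k\ne k'$. (c) Each set $\mathcal{H}_{b,k}$ is non-empty.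
   Context: Signal class: for $\epsilon_1,\epsilon_3>0$, $\mathcal{E}_{\epsilon_1,\epsilon_3}$ is the set of signals $x(t)=\sum_{k=1}^K x_k(t)$, $x_k(t)=A_k(t)e^{i2\pi\phi_k(t)}$, with $A_k\in L_\infty(\mathbb{R})$, $A_k(t)>0$, $\phi_k\in C^3(\mathbb{R})$, $\inf_b\phi_k'(b)>0$, $\sup_b\phi_k'(b)<\infty$, $|A_k(t+\tau)-A_k(t)|\le\epsilon_1|\tau|A_k(t)$ and $|\phi_k'''(t)|\le\epsilon_3$ for all $t,\tau\in\mathbb{R}$ and $1\le k\le K$. Window functions $g\in L_1(\mathbb{R})\cap L_2(\mathbb{R})$ decay to zero at $\infty$ and satisfy $\int_{\mathbb{R}}g(t)\,dt=1$. $\mu>0$ is a constant and $\sigma(b)$ is a positive function of $b$. The adaptive TSC-R is $$U_x(a,b,\lambda)=\int_{\mathbb{R}}x(b+at)\frac1{\sigma(b)}g\Big(\frac t{\sigma(b)}\Big)e^{-i2\pi\mu t-i\pi\lambda a^2t^2}\,dt,$$ with $b,\lambda\in\mathbb{R}$ and scale $a$. Throughout, for each $b$ all scales $a$ lie in an interval $a_1(b)\le a\le a_2(b)$, with $0<a_1(b)\le a_2(b)<\infty$. In particular the scales occurring in the sets $Z_k$ below lie in it: for all $k$ and $b$, every $a>0$ with $|\mu-a\phi_k'(b)|<\Delta$ lies in $[a_1(b),a_2(b)]$. Polynomial Fourier transform: $\breve g(\eta,\lambda)=\int_{\mathbb{R}}g(t)e^{-i2\pi\eta t-i\pi\lambda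 t^2}dt$. $\nu(b)=\min_{1\le k\le K}A_k(b)$, $M(b)=\sum_{k=1}^KA_k(b)$, $I_n=\int_{\mathbb{R}}|g(t)t^n|dt$, and $$\Pi_0(b)=\epsilon_1I_1\sigma(b)a_2(b)+\frac\pi3\epsilon_3I_3\sigma^3(b)a_2(b)^3.$$ $Z_k=\{(a,b,\lambda):|\mu-a\phi_k'(b)|<\Delta\ \text{and}\ |\lambda-\phi_k''(b)|<\Delta_1,\ b\in\mathbb{R}\}$. $\Upsilon(b)$ and $\Upsilon_{\ell,k}(b)$ ($k\ne\ell$) are functions with $\Upsilon(b)\ge\Upsilon_{\ell,k}(b)$ such that, writing $G_k(a,b,\lambda)=\big|\breve g\big(\sigma(b)(\mu-a\phi_k'(b)),\ \sigma^2(b)a^2(\lambda-\phi_k''(b))\big)\big|$, $$\sup_{\{(a,\lambda):(a,b,\lambda)\notin\bigcup_{j=1}^KZ_j\}}G_k(a,b,\lambda)\le\Upsilon(b)\ (1\le k\le K),\qquad \sup_{\{(a,\lambda):(a,b,\lambda)\in Z_\ell\}}G_k(a,b,\lambda)\le\Upsilon_{\ell,k}(b)\ (k\ne\ell).$$ $\mathcal{H}_b=\{(a,\lambda):|U_x(a,b,\lambda)|>\widetilde\epsilon_1\}$ and $\mathcal{H}_{b,k}=\{(a,\lambda)\in\mathcal{H}_b:|\mu-a\phi_k'(b)|<\Delta\ \text{and}\ |\lambda-\phi_k''(b)|<\Delta_1\}$. *)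

(* Defs.v *)
From HB Require Import structures.
From mathcomp Require Import all_boot all_order all_algebra.
From mathcomp Require Import complex.
From mathcomp Require Import all_classical all_reals all_analysis.

Set Implicit Arguments.
Unset Strict Implicit.
Unset Printing Implicit Defensive.

Import Order.TTheory GRing.Theory Num.Theory.
Import numFieldNormedType.Exports.

Local Open Scope classical_set_scope.
Local Open Scope ring_scope.

Notation modulus := Normc.normc.

(* [expi x] is e^{i x} for a real x. *)
Definition expi (R : realType) (x : R) : R[i] := Complex (cos x) (sin x).

(* The libraries only integrate real functions, so integrability and integrals
   of complex functions are taken componentwise. *)
Definition cLfun (R : realType) (p : \bar R) (f : R -> R[i]) : Prop :=
  (fun t => complex.Re (f t)) \in Lfun (@lebesgue_measure R) p /\
  (fun t => complex.Im (f t)) \in Lfun (@lebesgue_measure R) p.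

Definition cintegral (R : realType) (f : R -> R[i]) : R[i] :=
  Complex (\int[@lebesgue_measure R]_t complex.Re (f t))
          (\int[@lebesgue_measure R]_t complex.Im (f t)).

Definition class_C (R : realType) (n : nat) (f : R -> R) : Prop :=
  (forall m t, (m < n)%N -> derivable (derive1n m f) t 1) /\
  continuous (derive1n n f).

Definition signal (R : realType) (K : nat) (A phi : 'I_K -> R -> R) (t : R)
    : R[i] :=
  \sum_(k < K) (A k t)%:C%C * expi (2 * pi * phi k t).

(* The components (A_k, phi_k) exhibit [signal A phi] as a member of the class
   E_{eps1,eps3}; the class is a condition on this decomposition. *)
Definition in_class (R : realType) (eps1 eps3 : R) (K : nat)
    (A phi : 'I_K -> R -> R) : Prop :=
  forall k : 'I_K,
    (A k \in Lfun (@lebesgue_measure R) +oo%E) /\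
    (forall t, 0 < A k t) /\
    class_C 3 (phi k) /\
    (0 < ereal_inf (range (EFin \o derive1 (phi k))))%E /\
    (ereal_sup (range (EFin \o derive1 (phi k))) < +oo)%E /\
    (forall t tau, `|A k (t + tau) - A k t| <= eps1 * `|tau| * A k t) /\
    (forall t, `|derive1n 3 (phi k) t| <= eps3).

Definition window (R : realType) (g : R -> R[i]) : Prop :=
  cLfun 1%E g /\ cLfun 2%:E%E g /\
  (modulus (g t) @[t --> +oo] --> (0 : R)) /\
  (modulus (g t) @[t --> -oo] --> (0 : R)) /\
  cintegral g = 1.

Definition tscr (R : realType) (mu : R) (sigma : R -> R) (g x : R -> R[i])
    (a b lambda : R) : R[i] :=
  cintegral (fun t => x (b + a * t) * ((sigma b)^-1)%:C%C * g (t / sigma b) *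
    expi (- (2 * pi * mu * t) - pi * lambda * a ^+ 2 * t ^+ 2)).

Definition poly_fourier (R : realType) (g : R -> R[i]) (eta lambda : R)
    : R[i] :=
  cintegral (fun t => g t *
    expi (- (2 * pi * eta * t) - pi * lambda * t ^+ 2)).

(* Extended-real valued, for nonempty families; +oo is the unit of min. *)
Definition amp_min (R : realType) (K : nat) (A : 'I_K -> R -> R) (b : R)
    : \bar R :=
  \big[Order.min/+oo%E]_(k < K) (A k b)%:E.

Definition amp_sum (R : realType) (K : nat) (A : 'I_K -> R -> R) (b : R) : R :=
  \sum_(k < K) A k b.

(* Possibly +oo: no integrability of g t^n is presupposed. *)
Definition abs_moment (R : realType) (g : R -> R[i]) (n : nat) : \bar R :=
  (\int[@lebesgue_measure R]_t (modulus (g t * (t ^+ n)%:C%C))%:E)%E.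

Definition Pi0 (R : realType) (eps1 eps3 : R) (g : R -> R[i])
    (sigma a2 : R -> R) (b : R) : \bar R :=
  (eps1%:E * abs_moment g 1 * (sigma b)%:E * (a2 b)%:E +
   (pi / 3 * eps3)%:E * abs_moment g 3 * (sigma b ^+ 3)%:E * (a2 b ^+ 3)%:E)%E.

(* From here on, sets of pairs (a, lambda) are sections at a fixed time b.
   The scales admitted at time b form the interval [a1 b, a2 b]. *)
Definition scale_domain (R : realType) (a1 a2 : R -> R) (b : R) : set (R * R) :=
  [set p | a1 b <= p.1 <= a2 b].

Definition zone (R : realType) (K : nat) (phi : 'I_K -> R -> R)
    (mu Delta Delta1 : R) (k : 'I_K) (b : R) : set (R * R) :=
  [set p | `|mu - p.1 * derive1 (phi k) b| < Delta /\
           `|p.2 - derive1n 2 (phi k) b| < Delta1].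

(* The quantity G_k(a, b, lambda), p = (a, lambda). *)
Definition comp_size (R : realType) (K : nat) (phi : 'I_K -> R -> R) (mu : R)
    (sigma : R -> R) (g : R -> R[i]) (k : 'I_K) (b : R) (p : R * R) : R :=
  modulus (poly_fourier g (sigma b * (mu - p.1 * derive1 (phi k) b))
    (sigma b ^+ 2 * p.1 ^+ 2 * (p.2 - derive1n 2 (phi k) b))).

Definition Hset (R : realType) (mu : R) (sigma a1 a2 : R -> R)
    (g x : R -> R[i]) (epst : R -> R) (b : R) : set (R * R) :=
  [set p | scale_domain a1 a2 b p /\
           epst b < modulus (tscr mu sigma g x p.1 b p.2)].

Definition Hcomp (R : realType) (K : nat) (phi : 'I_K -> R -> R)
    (mu Delta Delta1 : R) (sigma a1 a2 : R -> R)
    (g x : R -> R[i]) (epst : R -> R) (b : R) (k : 'I_K) : set (R * R) :=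
  Hset mu sigma a1 a2 g x epst b `&` zone phi mu Delta Delta1 k b.

(* Main.v *)
Require Import Defs.
From HB Require Import structures.
From mathcomp Require Import all_boot all_order all_algebra.
From mathcomp Require Import complex.
From mathcomp Require Import all_classical all_reals all_analysis.
From mathcomp Require Import measurable_realfun.
From mathcomp Require Import ring lra.
Import Order.TTheory GRing.Theory Num.Theory.
Import numFieldNormedType.Exports.
Local Open Scope classical_set_scope.
Local Open Scope ring_scope.

(** The transform is, up to a small error, a superposition of one known profile
    per component. Near the time [b], the component A_k e^{i 2 pi phi_k} is
    A_k(b) times an exponential with quadratic phase: the amplitude condition
    controls the change of A_k, the bound on phi_k''' controls the remainder of
    the second-order Taylor expansion of the phase, and x |-> e^{ix} is
    1-Lipschitz ([local_model]). Tested against the dilated window, the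
    quadratic-phase exponential gives exactly A_k(b) e^{i 2 pi phi_k(b)} times
    the polynomial Fourier transform of g at (sigma (mu - a phi_k'),
    sigma^2 a^2 (lambda - phi_k'')), while the error integrates to first and third
    absolute moments of g, that is, to A_k(b) times the quantity defining Pi0,
    taken at the actual scale a ([component_approx], [tscr_approx]).

    Hence, wherever all the profiles are at most Ups, the transform is at most
    M (Ups + Pi0), below the threshold ([tscr_upper]). This happens outside all
    zones, which gives (a). It also happens where two zones overlap: every
    component is then off resonance with respect to at least one of the two zones,
    so the bounds Upslk apply to all of them. This gives (b).

    For (c), take a = mu / phi_k'(b) and lambda = phi_k''(b). The k-th profile is
    there the integral of g, which is 1, and the others are at most Ups, so the
    transform is at least A_k(b) - M (Ups + error at scale a) ([tscr_lower]). The
    threshold is at most nu(b) - M (Ups + Pi0), and it remains to find a strict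
    inequality. It comes from the error: the scales of a zone form an open
    interval contained in the admitted ones, so a < a2(b), and the error is
    strictly increasing in the scale ([scale_error_lt]) because the first moment of
    g is positive ([abs_moment1_gt0]). *)

(** * The modulus and the unit circle *)

Section ComplexNumbers.
Context {R : realType}.
Implicit Types (z w : R[i]) (x y : R).

Lemma modulusE z : modulus z = Num.sqrt (complex.Re z ^+ 2 + complex.Im z ^+ 2).
Proof. by case: z. Qed.

Lemma modulus_ge0 z : 0 <= modulus z.
Proof. by rewrite modulusE sqrtr_ge0. Qed.

Lemma sqr_modulus z : modulus z ^+ 2 = complex.Re z ^+ 2 + complex.Im z ^+ 2.
Proof. by rewrite modulusE sqr_sqrtr// addr_ge0 ?sqr_ge0. Qed.

Lemma modulus_real x : modulus x%:C%C = `|x|.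
Proof. by rewrite modulusE /= expr0n addr0 sqrtr_sqr. Qed.

Lemma normr_Re_le z : `|complex.Re z| <= modulus z.
Proof. by rewrite modulusE -sqrtr_sqr ler_wsqrtr// lerDl sqr_ge0. Qed.

Lemma normr_Im_le z : `|complex.Im z| <= modulus z.
Proof. by rewrite modulusE -sqrtr_sqr ler_wsqrtr// lerDr sqr_ge0. Qed.

Lemma modulus_sub z w : modulus z - modulus w <= modulus (z - w).
Proof. by rewrite lerBlDr (le_trans _ (le_normcD _ _))// subrK. Qed.

Lemma modulus_sum (I : Type) (r : seq I) (F : I -> R[i]) :
  modulus (\sum_(i <- r) F i) <= \sum_(i <- r) modulus (F i).
Proof.
elim: r => [|i r IH]; first by rewrite !big_nil Normc.normc0.
by rewrite !big_cons (le_trans (le_normcD _ _))// lerD2l.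
Qed.

Lemma cauchy_schwarz_plane z w :
  complex.Re z * complex.Re w + complex.Im z * complex.Im w <=
  modulus z * modulus w.
Proof.
rewrite (le_trans (ler_norm _))// -ler_sqr ?nnegrE ?mulr_ge0 ?modulus_ge0//.
rewrite real_normK ?num_real// exprMn !sqr_modulus.
have := sqr_ge0 (complex.Re z * complex.Im w - complex.Im z * complex.Re w).
nra.
Qed.

Lemma modulus_expi x : modulus (expi x) = 1.
Proof. by rewrite modulusE /= cos2Dsin2 sqrtr1. Qed.

Lemma expiD x y : expi (x + y) = expi x * expi y.
Proof.
apply/eqP; rewrite eq_complex /=.
by rewrite cosD sinD eqxx /= addrC [cos x * _]mulrC mulrC eqxx.
Qed.

Lemma expi0 : expi (0 : R) = 1.
Proof. by rewrite /expi cos0 sin0. Qed.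

End ComplexNumbers.

(** * Taylor bounds from derivative bounds *)

Section Taylor.
Context {R : realType}.
Implicit Types (f df : R -> R) (s t : R).

Lemma is_derive_monomial (c : R) n s :
  is_derive s 1 (fun t => c * t ^+ n.+1) (c * n.+1%:R * s ^+ n).
Proof.
have := is_deriveZ c (is_deriveX n.+1 (is_derive_id s (1 : R))).
by rewrite exprfctE /GRing.scale /= mulr1 mulrA.
Qed.

Lemma le_primitive_monomial f df (C : R) n :
  (forall s : R, is_derive s 1 f (df s)) -> f 0 = 0 ->
  (forall s, 0 <= s -> df s <= C * s ^+ n) ->
  forall s, 0 <= s -> f s <= C * s ^+ n.+1 / n.+1%:R.
Proof.
move=> fD f0 dfle s s0.
pose h t := (C / n.+1%:R) * t ^+ n.+1 - f t.
have hD t : is_derive t 1 h (C * t ^+ n - df t).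
  rewrite -[C in C * _](@divfK _ n.+1%:R) ?pnatr_eq0//.
  exact: (is_deriveB (is_derive_monomial _ _ _)).
have h0 : h 0 = 0 by rewrite /h f0 expr0n mulr0 subr0.
have : h 0 <= h s.
  apply: (@ger0_derive1_ndecry _ h 0) => // [t|].
  - by rewrite in_itv /= andbT => /ltW t0; rewrite derive1E derive_val subr_ge0 dfle.
  - apply: continuous_subspaceT => t.
    apply: differentiable_continuous; apply/derivable1_diffP.
    exact: ex_derive.
by rewrite h0 subr_ge0 mulrAC.
Qed.

(** The bound on the derivative is a monomial, as is the bound obtained, so that
    the lemma can be iterated. *)
Lemma normr_primitive_monomial f df (C : R) n :
  (forall s : R, is_derive s 1 f (df s)) -> f 0 = 0 ->
  (forall s, `|df s| <= C * `|s| ^+ n) ->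
  forall s, `|f s| <= C * `|s| ^+ n.+1 / n.+1%:R.
Proof.
have pos (g dg : R -> R) : (forall s : R, is_derive s 1 g (dg s)) -> g 0 = 0 ->
    (forall s, `|dg s| <= C * `|s| ^+ n) ->
    forall s, 0 <= s -> `|g s| <= C * s ^+ n.+1 / n.+1%:R.
  move=> gD g0 dgle s s0; rewrite ler_norml lerNl; apply/andP; split.
    apply: (@le_primitive_monomial (\- g) (\- dg)) => //.
      by rewrite /= g0 oppr0.
    by move=> t t0; rewrite (le_trans (ler_norm _))// normrN -{2}(ger0_norm t0).
  apply: (@le_primitive_monomial g dg) => // t t0.
  by rewrite (le_trans (ler_norm _))// -{2}(ger0_norm t0).
move=> fD f0 dfle s; have [s0|s0] := lerP 0 s.
  by rewrite (ger0_norm s0); apply: (pos _ _ fD f0 _ s s0).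
rewrite (ltr0_norm s0).
have := pos (f \o -%R) (fun t => - df (- t)); rewrite /comp oppr0 f0.
move=> /(_ _ erefl _ (- s)); rewrite opprK; apply; last by rewrite oppr_ge0 ltW.
  move=> t; have := @is_derive1_comp _ f -%R t (df (-t)) (-1).
  by rewrite mulrN1; apply.
by move=> t; rewrite normrN (le_trans (dfle _))// normrN.
Qed.

Lemma class_C_is_derive n f m s : class_C n f -> (m < n)%N ->
  is_derive s 1 (derive1n m f) (derive1n m.+1 f s).
Proof.
move=> [df _] mn; rewrite /derive1n iterS derive1E.
by apply/derivableP; exact: df.
Qed.

(** The bound on the third derivative is integrated three times, each time for
    the remainder of a Taylor expansion, which vanishes at 0. *)
Lemma taylor2_error f (M b h : R) : class_C 3 f ->
  (forall s, `|derive1n 3 f s| <= M) ->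
  `|f (b + h) - (f b + derive1 f b * h + derive1n 2 f b * h ^+ 2 / 2)| <=
  M * `|h| ^+ 3 / 6.
Proof.
move=> fC fM.
have D m s : (m < 3)%N ->
    is_derive s 1 (fun t => derive1n m f (b + t)) (derive1n m.+1 f (b + s)).
  move=> m3; have Db := class_C_is_derive _ _ _ (b + s) fC m3.
  have := @is_derive1_comp _ (derive1n m f) (+%R b) s (derive1n m.+1 f (b + s)) 1.
  rewrite mulr1; apply => //.
  by apply: is_derive_eq; rewrite add0r.
have B2 := normr_primitive_monomial
  (fun t => derive1n 2 f (b + t) - derive1n 2 f b)
  (fun t => derive1n 3 f (b + t)) M 0.
have B1 := normr_primitive_monomial
  (fun t => derive1n 1 f (b + t) - derive1n 1 f b - derive1n 2 f b * t)
  (fun t => derive1n 2 f (b + t) - derive1n 2 f b) M 1.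
have B0 := normr_primitive_monomial
  (fun t => f (b + t) - f b - derive1 f b * t - derive1n 2 f b / 2 * t ^+ 2)
  (fun t => derive1n 1 f (b + t) - derive1n 1 f b - derive1n 2 f b * t)
  (M / 2) 2.
have := B0 _ _ _ h.
have -> : f (b + h) - f b - derive1 f b * h - derive1n 2 f b / 2 * h ^+ 2 =
  f (b + h) - (f b + derive1 f b * h + derive1n 2 f b * h ^+ 2 / 2) by ring.
have -> : M / 2 * `|h| ^+ 3 / 3 = M * `|h| ^+ 3 / 6 by field.
apply.
- move=> s; have Ds := D 0%N s isT; rewrite /= in Ds.
  have := is_deriveB (is_deriveB (is_deriveB Ds (is_derive_cst (f b) s 1))
    (is_derive_monomial (derive1 f b) 0 s))
    (is_derive_monomial (derive1n 2 f b / 2) 1 s).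
  by rewrite subr0 expr0 !mulr1 divfK.
- by rewrite addr0; ring.
- move=> s; have := B1 _ _ _ s.
  have -> : M * `|s| ^+ 2 / 2 = M / 2 * `|s| ^+ 2 by ring.
  apply.
  - move=> t; have := is_deriveB (is_deriveB (D 1%N t isT)
      (is_derive_cst (derive1n 1 f b) t 1))
      (is_derive_monomial (derive1n 2 f b) 0 t).
    by rewrite subr0 expr0 !mulr1.
  - by rewrite addr0; ring.
  - move=> t; have := B2 _ _ _ t; rewrite divr1; apply.
    + move=> u; have := is_deriveB (D 2%N u isT)
        (is_derive_cst (derive1n 2 f b) u 1).
      by rewrite subr0.
    + by rewrite addr0 subrr.
    + by move=> u; rewrite expr0 mulr1.
Qed.

Lemma normr_sin_le x : `|sin x| <= `|x| :> R.
Proof.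
have := normr_primitive_monomial sin cos 1 0 _ (sin0 R) _ x.
rewrite divr1 mul1r; apply=> s.
by rewrite mul1r expr0 cos_max.
Qed.

Lemma one_sub_cos_le x : 1 - cos x <= x ^+ 2 / 2 :> R.
Proof.
have := normr_primitive_monomial (fun t => 1 - cos t) sin 1 1 _ _ _ x.
rewrite mul1r real_normK ?num_real// => H.
apply: le_trans (ler_norm _) (H _ _ _).
- move=> s; have := is_deriveB (is_derive_cst (1 : R) s 1) (is_derive_cos s).
  by rewrite sub0r opprK.
- by rewrite cos0 subrr.
- by move=> s; rewrite mul1r expr1 normr_sin_le.
Qed.

End Taylor.

(** * Lipschitz continuity of the complex exponential *)

Section Oscillation.
Context {R : realType}.

(** The squared chord is [2 - 2 cos (x - y)]. *)
Lemma modulus_expi_sub (x y : R) : modulus (expi x - expi y) <= `|x - y|.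
Proof.
rewrite -ler_sqr ?nnegrE ?modulus_ge0// sqr_modulus real_normK ?num_real//=.
have := one_sub_cos_le (x - y); rewrite cosB.
have := cos2Dsin2 x; have := cos2Dsin2 y.
move: (cos x) (cos y) (sin x) (sin y) (x - y) => a b c d e.
nra.
Qed.

End Oscillation.

(** * Integrals of complex functions *)

Section ComplexIntegral.
Context {R : realType}.
Local Notation leb := (@lebesgue_measure R).
Implicit Types (f g : R -> R[i]) (h : R -> R).

Definition cmeasurable f : Prop :=
  measurable_fun setT (fun t => complex.Re (f t)) /\
  measurable_fun setT (fun t => complex.Im (f t)).

Definition cintegrable f : Prop :=
  leb.-integrable setT (EFin \o (fun t => complex.Re (f t))) /\
  leb.-integrable setT (EFin \o (fun t => complex.Im (f t))).

Lemma cintegrable_measurable f : cintegrable f -> cmeasurable f.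
Proof.
by move=> [/integrableP[/measurable_EFinP mr _] /integrableP[/measurable_EFinP mi _]].
Qed.

Lemma cLfun1_integrable f : cLfun 1%E f -> cintegrable f.
Proof. by move=> [/Lfun1_integrable ? /Lfun1_integrable ?]. Qed.

Lemma cmeasurable_real h : measurable_fun setT h ->
  cmeasurable (fun t => (h t)%:C%C).
Proof. by move=> mh; split => //=; exact: measurable_cst. Qed.

Lemma cmeasurable_expi h : measurable_fun setT h ->
  cmeasurable (fun t => expi (h t)).
Proof.
move=> mh; split => /=.
- apply: (measurableT_comp (f := @cos R)) => //.
  by apply: continuous_measurable_fun; exact: continuous_cos.
- apply: (measurableT_comp (f := @sin R)) => //.
  by apply: continuous_measurable_fun; exact: continuous_sin.
Qed.

Lemma cmeasurableB f g : cmeasurable f -> cmeasurable g ->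
  cmeasurable (fun t => f t - g t).
Proof.
move=> [fr fi] [gr gi].
have -> : (fun t => f t - g t) =
    (fun t => Complex (complex.Re (f t) - complex.Re (g t))
                      (complex.Im (f t) - complex.Im (g t))).
  by apply/funext => t; case: (f t) => a b; case: (g t).
by split => /=; exact: measurable_funB.
Qed.

Lemma cmeasurableM f g : cmeasurable f -> cmeasurable g ->
  cmeasurable (fun t => f t * g t).
Proof.
move=> [fr fi] [gr gi].
have -> : (fun t => f t * g t) = (fun t => Complex
     (complex.Re (f t) * complex.Re (g t) - complex.Im (f t) * complex.Im (g t))
     (complex.Re (f t) * complex.Im (g t) + complex.Im (f t) * complex.Re (g t))).
  by apply/funext => t; case: (f t) => a b; case: (g t).
split => /=.
- by apply: measurable_funB; exact: measurable_funM.
- by apply: measurable_funD; exact: measurable_funM.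
Qed.

Lemma measurable_modulus f : cmeasurable f ->
  measurable_fun setT (fun t => modulus (f t)).
Proof.
move=> [fr fi].
under eq_fun do rewrite modulusE.
apply: (measurableT_comp (f := @Num.sqrt R)).
  by apply: continuous_measurable_fun; exact: sqrt_continuous.
by apply: measurable_funD; exact: measurable_funX.
Qed.

Lemma cintegrable_dominated f h : cmeasurable f ->
  leb.-integrable setT (EFin \o h) -> (forall t, modulus (f t) <= h t) ->
  cintegrable f.
Proof.
move=> [fr fi] hI fh.
split; (apply: (le_integrable _ _ _ hI) => //; first exact/measurable_EFinP);
  move=> t _ /=; rewrite lee_fin (le_trans _ (ler_norm _))//;
  rewrite (le_trans _ (fh t))//.
- exact: normr_Re_le.
- exact: normr_Im_le.
Qed.

Lemma integrable_modulus f : cintegrable f ->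
  leb.-integrable setT (EFin \o (fun t => modulus (f t))).
Proof.
move=> fI; have [fr fi] := fI.
have := integrableD measurableT (integrable_abse fr) (integrable_abse fi).
apply: le_integrable => //.
  apply/measurable_EFinP; exact: (measurable_modulus _ (cintegrable_measurable _ fI)).
move=> t _ /=; rewrite lee_fin ger0_norm ?modulus_ge0// ger0_norm ?addr_ge0//.
rewrite -ler_sqr ?nnegrE ?addr_ge0 ?modulus_ge0// sqr_modulus sqrrD !real_normK ?num_real//.
by rewrite addrAC lerDl mulrn_wge0// mulr_ge0.
Qed.

Let integrable_addr (u v : R -> R) : leb.-integrable setT (EFin \o u) ->
  leb.-integrable setT (EFin \o v) ->
  leb.-integrable setT (EFin \o (fun t => u t + v t)).
Proof.
move=> uI vI; rewrite (_ : EFin \o _ = (EFin \o u) \+ (EFin \o v))%E//.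
exact: integrableD.
Qed.

Let integrable_subr (u v : R -> R) : leb.-integrable setT (EFin \o u) ->
  leb.-integrable setT (EFin \o v) ->
  leb.-integrable setT (EFin \o (fun t => u t - v t)).
Proof.
move=> uI vI; rewrite (_ : EFin \o _ = (EFin \o u) \- (EFin \o v))%E//.
exact: integrableB.
Qed.

Let integrable_scaler (c : R) (u : R -> R) : leb.-integrable setT (EFin \o u) ->
  leb.-integrable setT (EFin \o (fun t => c * u t)).
Proof.
move=> uI; rewrite (_ : EFin \o _ = fun t => c%:E * (EFin \o u) t)%E//.
exact: integrableZl.
Qed.

Lemma cintegrableD f g : cintegrable f -> cintegrable g ->
  cintegrable (fun t => f t + g t) /\
  cintegral (fun t => f t + g t) = cintegral f + cintegral g.
Proof.
move=> [fr fi] [gr gi].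
have -> : (fun t => f t + g t) =
    (fun t => Complex (complex.Re (f t) + complex.Re (g t))
                      (complex.Im (f t) + complex.Im (g t))).
  by apply/funext => t; case: (f t) => a b; case: (g t).
split; first by split; exact: integrable_addr.
by rewrite /cintegral /= !RintegralD.
Qed.

Lemma cintegrableZ f (z : R[i]) : cintegrable f ->
  cintegrable (fun t => z * f t) /\
  cintegral (fun t => z * f t) = z * cintegral f.
Proof.
case: z => a b [fr fi].
have -> : (fun t => Complex a b * f t) =
    (fun t => Complex (a * complex.Re (f t) - b * complex.Im (f t))
                      (a * complex.Im (f t) + b * complex.Re (f t))).
  by apply/funext => t; case: (f t).
split; first split.
- by apply: integrable_subr => //; exact: integrable_scaler.
- by apply: integrable_addr => //; exact: integrable_scaler.
- by rewrite /cintegral /= RintegralB ?RintegralD ?RintegralZl//; exact: integrable_scaler.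
Qed.

Lemma cintegrable_sum (I : Type) (r : seq I) (F : I -> R -> R[i]) :
  (forall i, cintegrable (F i)) ->
  cintegrable (fun t => \sum_(i <- r) F i t) /\
  cintegral (fun t => \sum_(i <- r) F i t) = \sum_(i <- r) cintegral (F i).
Proof.
move=> FI; elim: r => [|i r [IH1 IH2]].
  rewrite big_nil; under eq_fun do rewrite big_nil.
  split; first by split; exact: integrable0.
  by rewrite /cintegral /Rintegral /= integral0.
rewrite big_cons; under eq_fun do rewrite big_cons.
by have [? ->] := cintegrableD _ _ (FI i) IH1; rewrite IH2.
Qed.

(** With [z] the integral of [f], |z|^2 is the integral of the scalar product of [z]
    and [f t], hence at most |z| times the integral of [h]. *)
Lemma modulus_cintegral_le f h : cintegrable f ->
  leb.-integrable setT (EFin \o h) -> (forall t, modulus (f t) <= h t) ->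
  modulus (cintegral f) <= \int[leb]_t h t.
Proof.
move=> [fr fi] hI fh; set z := cintegral f.
have h0 t : 0 <= h t := le_trans (modulus_ge0 _) (fh t).
have [z0|z0] := eqVneq (modulus z) 0; first by rewrite z0 Rintegral_ge0.
have zgt0 : 0 < modulus z by rewrite lt0r z0 modulus_ge0.
rewrite -(ler_pM2l zgt0) -expr2 sqr_modulus !expr2.
rewrite -!RintegralZl//.
rewrite -RintegralD//; [|exact: integrable_scaler|exact: integrable_scaler].
apply: le_Rintegral => //; [|exact: integrable_scaler|].
  by apply: integrable_addr => //; exact: integrable_scaler.
move=> t _; apply: le_trans (cauchy_schwarz_plane _ _) _.
by rewrite ler_pM2l.
Qed.

End ComplexIntegral.

(** * Change of scale *)

Section Scaling.
Context {R : realType}.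
Local Notation leb := (@lebesgue_measure R).

Lemma measurable_divr (s : R) : measurable_fun setT (fun t : R => t / s).
Proof.
by apply: (@measurable_funM _ _ _ setT id (cst s^-1)) => //; exact: measurable_id.
Qed.

(** The image measure divided by [s] gives every interval its length, which
    characterizes Lebesgue measure. *)
Lemma lebesgue_measure_scale (s : R) (A : set R) : 0 < s -> measurable A ->
  pushforward leb ((fun t => t / s) : _ -> measurableTypeR R) A =
  (s%:E * leb A)%E.
Proof.
move=> s0 mA.
have ms : measurable_fun setT ((fun t => t / s) : _ -> measurableTypeR R)
  := measurable_divr s.
have s1 : 0 <= s^-1 by rewrite invr_ge0 ltW.
have sV : (s^-1 * s = 1)%R by rewrite mulVf// gt_eqF.
pose ps : {measure set (measurableTypeR R) -> \bar R} :=
  pushforward leb ((fun t => t / s) : _ -> measurableTypeR R).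
pose k : {nonneg R} := NngNum s1.

have -> // : leb A = mscale k (ps ms) A.
  apply: lebesgue_measure_unique => // _ [[a b] _ <-].
  change (leb `]a, b]%classic =
    s^-1%:E * leb ((fun t : R => t / s)%R @^-1` `]a, b]%classic))%E.
  rewrite (_ : _ @^-1` _ = `](a * s), (b * s)]%classic); last first.
    by apply/seteqP; split=> x /=; rewrite !in_itv /= ltr_pdivlMr// ler_pdivrMr.
  rewrite !lebesgue_measure_itv /= !lte_fin ltr_pM2r//.
  case: ifP => _; last by rewrite mule0.
  by rewrite -!EFinD -EFinM -mulrBl mulrCA sV mulr1.
rewrite [X in (s%:E * X)%E](_ : _ =
  s^-1%:E * pushforward leb (fun t : R => t / s)%R A)%E//.
by rewrite muleA -EFinM divff ?mul1e ?gt_eqF.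
Qed.

Lemma ge0_integral_scale (s : R) (f : R -> \bar R) : 0 < s ->
  measurable_fun setT f -> (forall t, 0 <= f t)%E ->
  (\int[leb]_t f (t / s)%R = s%:E * \int[leb]_t f t)%E.
Proof.
move=> s0 mf f0.
have ms : measurable_fun setT ((fun t => t / s) : _ -> measurableTypeR R)
  := measurable_divr s.
have := @ge0_integral_pushforward _ _ (measurableTypeR R) (measurableTypeR R) R
  _ ms leb setT f measurableT mf.
rewrite preimage_setT => <-//.
pose k : {nonneg R} := NngNum (ltW s0).
rewrite -[s]/(k%:num) -ge0_integral_mscale//.
by apply: eq_measure_integral => A mA _; exact: lebesgue_measure_scale.
Qed.

(** The identity is transferred to the positive and negative parts, whose
    integrals always exist. *)
Lemma Rintegral_scale (s : R) (f : R -> R) : 0 < s -> measurable_fun setT f ->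
  \int[leb]_t (s^-1 * f (t / s)) = \int[leb]_t f t.
Proof.
move=> s0 mf; rewrite /Rintegral; congr fine.
have Ef : measurable_fun setT (EFin \o f) by exact/measurable_EFinP.
have sE : (s^-1%:E * s%:E = 1)%E by rewrite -EFinM mulVf ?gt_eqF.
have si : 0 <= s^-1 by rewrite invr_ge0 ltW.
rewrite integralE [RHS]integralE; congr (_ - _)%E.
- rewrite (_ : (fun t => (s^-1 * f (t / s))%:E) =
    (fun t => s^-1%:E * ((EFin \o f) \o (fun u => u / s)%R) t)%E)//.
  rewrite ge0_funeposM// funepos_comp ge0_integralZl//=.
  + rewrite (ge0_integral_scale _ (EFin \o f)^\+%E)// ?muleA ?sE ?mul1e//.
    exact: measurable_funepos.
  + exact: measurableT_comp (measurable_funepos Ef) (measurable_divr s).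
- rewrite (_ : (fun t => (s^-1 * f (t / s))%:E) =
    (fun t => s^-1%:E * ((EFin \o f) \o (fun u => u / s)%R) t)%E)//.
  rewrite ge0_funenegM// funeneg_comp ge0_integralZl//=.
  + rewrite (ge0_integral_scale _ (EFin \o f)^\-%E)// ?muleA ?sE ?mul1e//.
    exact: measurable_funeneg.
  + exact: measurableT_comp (measurable_funeneg Ef) (measurable_divr s).
Qed.

Lemma cintegral_scale (s : R) (f : R -> R[i]) : 0 < s -> cmeasurable f ->
  cintegral (fun t => (s^-1)%:C%C * f (t / s)) = cintegral f.
Proof.
move=> s0 [fr fi]; rewrite /cintegral -(Rintegral_scale s _ s0 fr).
rewrite -(Rintegral_scale s _ s0 fi); congr Complex; apply: eq_Rintegral => t _.
- by case: (f (t / s)) => u v /=; rewrite mul0r subr0.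
- by case: (f (t / s)) => u v /=; rewrite mul0r addr0.
Qed.

End Scaling.

(** * Local quadratic-phase model of one component *)

Section LocalModel.
Context {R : realType}.
Variables (A phi : R -> R) (eps1 eps3 : R).
Hypothesis A0 : forall t, 0 < A t.
Hypothesis phiC : class_C 3 phi.
Hypothesis dA : forall t tau, `|A (t + tau) - A t| <= eps1 * `|tau| * A t.
Hypothesis d3phi : forall t, `|derive1n 3 phi t| <= eps3.

(** Freezing the amplitude costs [eps1 |h|] and replacing the phase by its
    second-order Taylor polynomial costs [2 pi eps3 |h|^3 / 6], since
    [x |-> e^{ix}] is 1-Lipschitz. *)
Lemma local_model (b h : R) :
  modulus ((A (b + h))%:C%C * expi (2 * pi * phi (b + h)) -
    (A b)%:C%C * expi (2 * pi *
      (phi b + derive1 phi b * h + derive1n 2 phi b * h ^+ 2 / 2))) <=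
  A b * (eps1 * `|h| + pi / 3 * eps3 * `|h| ^+ 3).
Proof.
set p := phi (b + h); set q := phi b + _ + _.
have -> : (A (b + h))%:C%C * expi (2 * pi * p) - (A b)%:C%C * expi (2 * pi * q) =
    (A (b + h) - A b)%:C%C * expi (2 * pi * p) +
    (A b)%:C%C * (expi (2 * pi * p) - expi (2 * pi * q)).
  by rewrite raddfB /= mulrBl mulrBr addrA subrK.
apply: le_trans (le_normcD _ _) _.
rewrite !Normc.normcM !modulus_real modulus_expi mulr1 (gtr0_norm (A0 b)) [leRHS]mulrDr.
apply: lerD; first by rewrite mulrC; exact: dA.
rewrite ler_pM2l//; apply: le_trans (modulus_expi_sub _ _) _.
rewrite -mulrBr normrM ger0_norm ?mulr_ge0 ?pi_ge0//.
apply: le_trans (ler_wpM2l _ (taylor2_error _ _ _ _ phiC d3phi)) _.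
  by rewrite mulr_ge0 ?pi_ge0.
by rewrite le_eqVlt; apply/orP; left; apply/eqP; field.
Qed.

End LocalModel.

(** * Absolute moments of the window *)

Section Moments.
Context {R : realType}.
Local Notation leb := (@lebesgue_measure R).
Variable g : R -> R[i].
Hypothesis gI : cintegrable g.

Lemma cmeasurable_moment n : cmeasurable (fun t => g t * (t ^+ n)%:C%C).
Proof.
apply: (cmeasurableM _ (fun t => (t ^+ n)%:C%C)).
  exact: cintegrable_measurable.
by apply: cmeasurable_real; apply: measurable_funX; exact: measurable_id.
Qed.

Lemma abs_moment_ge0 n : (0 <= abs_moment g n)%E.
Proof. by apply: integral_ge0 => t _; rewrite lee_fin modulus_ge0. Qed.

Lemma modulus_moment n t :
  modulus (g t * (t ^+ n)%:C%C) = modulus (g t) * `|t| ^+ n.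
Proof. by rewrite Normc.normcM modulus_real normrX. Qed.

Lemma integrable_moment n : (abs_moment g n < +oo)%E ->
  leb.-integrable setT (EFin \o (fun t => modulus (g t) * `|t| ^+ n)).
Proof.
move=> fin; rewrite (_ : EFin \o _ =
  EFin \o (fun t => modulus (g t * (t ^+ n)%:C%C))); last first.
  by apply/funext => t /=; rewrite modulus_moment.
apply/integrableP; split.
  by apply/measurable_EFinP; exact: (measurable_modulus _ (cmeasurable_moment n)).
rewrite (_ : (\int[leb]_x _)%E = abs_moment g n)//.
by apply: eq_integral => t _ /=; rewrite ger0_norm// modulus_ge0.
Qed.

Lemma abs_momentE n : (abs_moment g n < +oo)%E ->
  abs_moment g n = (\int[leb]_t (modulus (g t) * `|t| ^+ n))%:E.
Proof.
move=> fin; rewrite /Rintegral; under eq_integral do rewrite -modulus_moment.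
by rewrite fineK// ge0_fin_numE// abs_moment_ge0.
Qed.

(** If the first moment vanished, [g] would vanish almost everywhere off the
    origin, hence almost everywhere, and could not have integral 1. *)
Lemma abs_moment1_gt0 : cintegral g = 1 -> (0 < abs_moment g 1)%E.
Proof.
move=> g1; rewrite lt0e abs_moment_ge0 andbT; apply/eqP => m0.
have mg1 := cmeasurable_moment 1.
have mg := cintegrable_measurable _ gI.
have : ae_eq leb setT (fun t => (modulus (g t * (t ^+ 1)%:C%C))%:E) (cst 0%E).
  apply/ae_eq_integral_abs => //.
    by apply/measurable_EFinP; exact: (measurable_modulus _ mg1).
  by rewrite -m0; apply: eq_integral => t _ /=; rewrite ger0_norm// modulus_ge0.
move=> g0.
have g00 : ae_eq leb setT (EFin \o (fun t => complex.Re (g t))) (cst 0%E).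
  have n0 : {ae leb, forall t, t != 0 :> R}.
    exists [set 0]; split => //; first exact: lebesgue_measure_set1.
    by move=> t /= /negP; rewrite negbK => /eqP.
  move: g0 n0; apply: filterS2 => t /= + t0 _ => /(_ I) [].
  rewrite modulus_moment expr1 => /eqP; rewrite mulf_eq0 normr_eq0 (negbTE t0).
  by rewrite orbF => /eqP/Normc.eq0_normc ->.
have : complex.Re (cintegral g) = 0.
  rewrite /= /Rintegral (ae_eq_integral (cst 0%E))//; first by rewrite integral0.
  by apply/measurable_EFinP; case: mg.
by rewrite g1 /= => /eqP; rewrite oner_eq0.
Qed.

End Moments.

(** * Transform of one component *)

Section Approximation.
Context {R : realType}.
Local Notation leb := (@lebesgue_measure R).
Variables (g : R -> R[i]) (eps1 eps3 : R).
Hypothesis gI : cintegrable g.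
Hypothesis m1 : (abs_moment g 1 < +oo)%E.
Hypothesis m3 : (abs_moment g 3 < +oo)%E.

Let i1 := \int[leb]_t (modulus (g t) * `|t| ^+ 1).
Let i3 := \int[leb]_t (modulus (g t) * `|t| ^+ 3).

Lemma cintegrable_poly_fourier (eta lambda : R) : cintegrable (fun t => g t *
    expi (- (2 * pi * eta * t) - pi * lambda * t ^+ 2)).
Proof.
apply: (cintegrable_dominated _ (fun t => modulus (g t))).
- apply: cmeasurableM; first exact: cintegrable_measurable.
  apply: cmeasurable_expi; apply: measurable_funB.
    apply: measurable_funN; apply: measurable_funM => //; exact: measurable_id.
  by apply: measurable_funM => //; exact: measurable_funX.
- exact: integrable_modulus.
- by move=> t; rewrite Normc.normcM modulus_expi mulr1.
Qed.

Section Component.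
Variables (A phi : R -> R).
Hypothesis Am : measurable_fun setT A.
Hypothesis A0 : forall t, 0 < A t.
Hypothesis phiC : class_C 3 phi.
Hypothesis dA : forall t tau, `|A (t + tau) - A t| <= eps1 * `|tau| * A t.
Hypothesis d3phi : forall t, `|derive1n 3 phi t| <= eps3.
Variables (mu a b lambda s : R).
Hypothesis a0 : 0 < a.
Hypothesis s0 : 0 < s.

(** The share of one component in the integrand of [tscr], after the substitution
    that turns the dilated window into [g]. *)
Definition tscr_component t := (A (b + a * (s * t)))%:C%C *
  expi (2 * pi * phi (b + a * (s * t))) * g t *
  expi (- (2 * pi * mu * (s * t)) - pi * lambda * a ^+ 2 * (s * t) ^+ 2).

Let component_model t := (A b)%:C%C * expi (2 * pi * phi b) * (g t *
  expi (- (2 * pi * (s * (mu - a * derive1 phi b)) * t) -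
    pi * (s ^+ 2 * a ^+ 2 * (lambda - derive1n 2 phi b)) * t ^+ 2)).

(** Freezing the amplitude at [b] and the phase at second order, the phase merges
    with the kernel of the transform into the kernel of [poly_fourier]. *)
Let component_modelE t : component_model t =
  (A b)%:C%C * expi (2 * pi * (phi b + derive1 phi b * (a * (s * t)) +
    derive1n 2 phi b * (a * (s * t)) ^+ 2 / 2)) * g t *
  expi (- (2 * pi * mu * (s * t)) - pi * lambda * a ^+ 2 * (s * t) ^+ 2).
Proof.
rewrite /component_model [g t * _]mulrC !mulrA -[_ * expi _ * expi _]mulrA -expiD.
rewrite [RHS]mulrAC -[_ * expi _ * expi _ in RHS]mulrA -expiD.
by congr (_ * expi _ * _); field.
Qed.

Lemma component_error t : modulus (tscr_component t - component_model t) <=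
  A b * (eps1 * s * a * (modulus (g t) * `|t| ^+ 1) +
    pi / 3 * eps3 * s ^+ 3 * a ^+ 3 * (modulus (g t) * `|t| ^+ 3)).
Proof.
rewrite component_modelE /tscr_component -!mulrBl !Normc.normcM modulus_expi mulr1.
have := local_model _ _ _ _ A0 phiC dA d3phi b (a * (s * t)).
rewrite !normrM (gtr0_norm a0) (gtr0_norm s0).
move=> /(ler_wpM2r (modulus_ge0 (g t)))/le_trans; apply.
by rewrite le_eqVlt; apply/orP; left; apply/eqP; ring.
Qed.

Lemma cmeasurable_component : cmeasurable tscr_component.
Proof.
have mt : measurable_fun setT (fun t : R => s * t).
  by apply: measurable_funM => //; exact: measurable_id.
have mb : measurable_fun setT (fun t : R => b + a * (s * t)).
  by apply: measurable_funD => //; exact: measurable_funM.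
apply: cmeasurableM; last first.
  apply: cmeasurable_expi; apply: measurable_funB.
    by apply: measurable_funN; apply: measurable_funM.
  by apply: measurable_funM => //; exact: measurable_funX.
apply: cmeasurableM; last exact: cintegrable_measurable.
apply: cmeasurableM.
  apply: (cmeasurable_real (fun t => A (b + a * (s * t)))).
  exact: (measurableT_comp Am mb).
apply: cmeasurable_expi; apply: measurable_funM => //.
apply: (measurableT_comp _ mb).
apply: continuous_measurable_fun => t.
apply: differentiable_continuous; apply/derivable1_diffP.
by have [+ _] := phiC; move=> /(_ 0%N t isT).
Qed.

(** Integrating the pointwise error of the local model against the window turns
    the powers of |t| into absolute moments. Integrability of the component
    itself also comes from that error being dominated by these moments. *)
Lemma component_approx :
  cintegrable tscr_component /\
  modulus (cintegral tscr_component - (A b)%:C%C * expi (2 * pi * phi b) *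
    poly_fourier g (s * (mu - a * derive1 phi b))
      (s ^+ 2 * a ^+ 2 * (lambda - derive1n 2 phi b))) <=
  A b * (eps1 * i1 * s * a + pi / 3 * eps3 * i3 * s ^+ 3 * a ^+ 3).
Proof.
have [modelI model_int] := cintegrableZ _ ((A b)%:C%C * expi (2 * pi * phi b))
  (cintegrable_poly_fourier (s * (mu - a * derive1 phi b))
    (s ^+ 2 * a ^+ 2 * (lambda - derive1n 2 phi b))).
rewrite -/component_model in modelI model_int.
have I1 := integrable_moment _ gI 1 m1.
have I3 := integrable_moment _ gI 3 m3.
pose k1 := A b * (eps1 * s * a); pose k3 := A b * (pi / 3 * eps3 * s ^+ 3 * a ^+ 3).
pose u1 t := k1 * (modulus (g t) * `|t| ^+ 1).
pose u3 t := k3 * (modulus (g t) * `|t| ^+ 3).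
have u1I : leb.-integrable setT (EFin \o u1) by exact: (integrableZl measurableT k1 I1).
have u3I : leb.-integrable setT (EFin \o u3) by exact: (integrableZl measurableT k3 I3).
have uI : leb.-integrable setT (EFin \o (fun t => u1 t + u3 t)).
  exact: (integrableD measurableT u1I u3I).
have eu t : modulus (tscr_component t - component_model t) <= u1 t + u3 t.
  by rewrite (le_trans (component_error t))// /u1 /u3 /k1 /k3 mulrDr !mulrA.
have eI : cintegrable (fun t => tscr_component t - component_model t).
  apply: cintegrable_dominated uI eu.
  apply: cmeasurableB; first exact: cmeasurable_component.
  exact: cintegrable_measurable.
have [] := cintegrableD _ _ modelI eI.
rewrite (_ : (fun t => component_model t + _) = tscr_component); last first.
  by apply/funext => t; rewrite addrC subrK.
move=> cI ->; split=> //; rewrite model_int addrAC subrr add0r.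
apply: le_trans (modulus_cintegral_le _ _ eI uI eu) _.
rewrite RintegralD// /u1 /u3 !RintegralZl// -/i1 -/i3 /k1 /k3.
by rewrite le_eqVlt; apply/orP; left; apply/eqP; ring.
Qed.

End Component.
End Approximation.

(** * Transform of the signal *)

Section SignalApproximation.
Context {R : realType}.
Local Notation leb := (@lebesgue_measure R).
Variables (eps1 eps3 : R) (K : nat) (A phi : 'I_K -> R -> R).
Hypothesis hx : in_class eps1 eps3 A phi.
Variable g : R -> R[i].
Hypothesis gI : cintegrable g.
Hypothesis m1 : (abs_moment g 1 < +oo)%E.
Hypothesis m3 : (abs_moment g 3 < +oo)%E.
Variables (mu : R) (sigma : R -> R) (b : R).
Hypothesis sigma0 : 0 < sigma b.

(** The error bound at the scale [a] actually used; [Pi0] is its value at the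
    largest admitted scale. *)
Definition scale_error (a : R) : R :=
  eps1 * (\int[leb]_t (modulus (g t) * `|t| ^+ 1)) * sigma b * a +
  pi / 3 * eps3 * (\int[leb]_t (modulus (g t) * `|t| ^+ 3)) * sigma b ^+ 3 * a ^+ 3.

Lemma Pi0_scale_error (a2 : R -> R) :
  Pi0 eps1 eps3 g sigma a2 b = (scale_error (a2 b))%:E.
Proof. by rewrite /Pi0 (abs_momentE _ 1)// (abs_momentE _ 3). Qed.

Lemma scale_error_le (a a' : R) : 0 < eps1 -> 0 < eps3 ->
  0 <= a -> a <= a' -> scale_error a <= scale_error a'.
Proof.
move=> e1 e3 a0 aa'; have mom0 n : 0 <= \int[leb]_t (modulus (g t) * `|t| ^+ n).
  by apply: Rintegral_ge0 => t _; rewrite mulr_ge0 ?modulus_ge0.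
apply: lerD; apply: ler_wpM2l => //.
- by rewrite !mulr_ge0// ltW.
- by rewrite !mulr_ge0 ?pi_ge0 ?exprn_ge0// ltW.
- by rewrite ler_pXn2r// nnegrE (le_trans a0).
Qed.

(** The strictness behind the non-emptiness of the ridges. *)
Lemma scale_error_lt (a a' : R) : 0 < eps1 -> 0 < eps3 ->
  (0 < abs_moment g 1)%E -> 0 <= a -> a < a' -> scale_error a < scale_error a'.
Proof.
move=> e1 e3; rewrite abs_momentE// lte_fin => i1 a0 aa'.
have i3 : 0 <= \int[leb]_t (modulus (g t) * `|t| ^+ 3).
  by apply: Rintegral_ge0 => t _; rewrite mulr_ge0 ?modulus_ge0.
apply: ltr_leD.
- by rewrite ltr_pM2l// !mulr_gt0.
- apply: ler_wpM2l; first by rewrite !mulr_ge0 ?pi_ge0 ?exprn_ge0// ltW.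
  by rewrite ler_pXn2r ?nnegrE ?(ltW aa')// (le_trans a0)// ltW.
Qed.

Lemma tscr_approx (a lambda : R) : 0 < a ->
  modulus (tscr mu sigma g (signal A phi) a b lambda -
    \sum_(k < K) (A k b)%:C%C * expi (2 * pi * phi k b) *
      poly_fourier g (sigma b * (mu - a * derive1 (phi k) b))
        (sigma b ^+ 2 * a ^+ 2 * (lambda - derive1n 2 (phi k) b)))
  <= amp_sum A b * scale_error a.
Proof.
move=> a0.
pose F k := tscr_component g (A k) (phi k) mu a b lambda (sigma b).
have approx k : cintegrable (F k) /\
  modulus (cintegral (F k) - (A k b)%:C%C * expi (2 * pi * phi k b) *
    poly_fourier g (sigma b * (mu - a * derive1 (phi k) b))
      (sigma b ^+ 2 * a ^+ 2 * (lambda - derive1n 2 (phi k) b))) <=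
  A k b * scale_error a.
  have [AL [A0 [phiC [_ [_ [dA d3phi]]]]]] := hx k.
  apply: component_approx => //.
  exact: (set_mem (sub_Lfun_mfun AL)).
have FI k := (approx k).1.
have -> : tscr mu sigma g (signal A phi) a b lambda = \sum_(k < K) cintegral (F k).
  have [sumI <-] := cintegrable_sum _ (index_enum 'I_K) F FI.
  rewrite -(cintegral_scale (sigma b)) ?sigma0//; last exact: cintegrable_measurable.
  congr cintegral; apply/funext => t.
  have st : sigma b * (t / sigma b) = t by rewrite mulrC divfK// gt_eqF.
  rewrite /F /tscr_component st /signal !mulr_suml mulr_sumr.
  by apply: eq_bigr => k _; rewrite mulrCA !mulrA [_ * (sigma b)^-1%:C%C]mulrC !mulrA.
rewrite -sumrB /amp_sum mulr_suml; apply: le_trans (modulus_sum _ _ _) _.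
by apply: ler_sum => k _; exact: (approx k).2.
Qed.

Let contribution k (p : R * R) : R[i] := (A k b)%:C%C * expi (2 * pi * phi k b) *
  poly_fourier g (sigma b * (mu - p.1 * derive1 (phi k) b))
    (sigma b ^+ 2 * p.1 ^+ 2 * (p.2 - derive1n 2 (phi k) b)).

Let modulus_contribution k p :
  modulus (contribution k p) = A k b * comp_size phi mu sigma g k b p.
Proof.
have [_ [A0 _]] := hx k.
by rewrite !Normc.normcM modulus_real modulus_expi mulr1 gtr0_norm.
Qed.

(** Where no component resonates, the transform is small. *)
Lemma tscr_upper (ups : R) (p : R * R) : 0 < p.1 ->
  (forall k, comp_size phi mu sigma g k b p <= ups) ->
  modulus (tscr mu sigma g (signal A phi) p.1 b p.2) <=
  amp_sum A b * (ups + scale_error p.1).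
Proof.
move=> p0 small; rewrite mulrDr addrC -lerBlDr.
have approx := tscr_approx p.1 p.2 p0.
apply: le_trans approx; rewrite lerBlDr -lerBlDl.
apply: le_trans (modulus_sub _ _) _; rewrite opprB addrC subrK.
apply: le_trans (modulus_sum _ _ _) _; rewrite /amp_sum mulr_suml.
apply: ler_sum => k _; rewrite (modulus_contribution k p) ler_wpM2l//.
by have [_ [A0 _]] := hx k; exact: ltW.
Qed.

(** At a resonance of the [k]-th component, the others cannot cancel it. *)
Lemma tscr_lower (ups : R) (k : 'I_K) (p : R * R) : 0 < p.1 -> 0 <= ups ->
  comp_size phi mu sigma g k b p = 1 ->
  (forall j, j != k -> comp_size phi mu sigma g j b p <= ups) ->
  A k b - amp_sum A b * (ups + scale_error p.1) <=
  modulus (tscr mu sigma g (signal A phi) p.1 b p.2).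
Proof.
move=> p0 ups0 one small.
have Aj0 j : 0 <= A j b by have [_ [A0 _]] := hx j; exact: ltW.
have approx := tscr_approx p.1 p.2 p0.
pose rest := \sum_(j < K | j != k) contribution j p.
rewrite (_ : \sum_(j < K) _ = contribution k p + rest) in approx; last first.
  exact: (bigD1 k).
have restM : modulus rest <= amp_sum A b * ups.
  rewrite /rest -big_filter; apply: le_trans (modulus_sum _ _ _) _.
  rewrite big_filter /amp_sum mulr_suml [leRHS](bigD1 k)//.
  rewrite -[leLHS]add0r; apply: lerD; first by rewrite mulr_ge0.
  apply: ler_sum => j jk; rewrite (modulus_contribution j p).
  by rewrite ler_wpM2l// small.
have := modulus_contribution k p; rewrite one mulr1 => Ak.
set U := tscr _ _ _ _ _ _ _ in approx *.
have : A k b <= modulus U + modulus rest + modulus (U - (contribution k p + rest)).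
  rewrite -Ak; have {1}-> : contribution k p =
    U + (- rest) + (- (U - (contribution k p + rest))) by ring.
  apply: le_trans (le_normcD _ _) _.
  rewrite [modulus (- (U - _))]normcN; apply: lerD.
    by apply: le_trans (le_normcD _ _) _; rewrite normcN.
  by [].
move=> AkU; rewrite mulrDr; lra.
Qed.

End SignalApproximation.
(** * Ridges of the transform *)

Theorem theorem1 (R : realType) (K : nat) (hK : (0 < K)%N)
    (eps1 eps3 : R) (heps1 : 0 < eps1) (heps3 : 0 < eps3)
    (A phi : 'I_K -> R -> R) (hx : in_class eps1 eps3 A phi)
    (g : R -> R[i]) (hg : window g)
    (mu : R) (hmu : 0 < mu)
    (sigma : R -> R) (hsigma : forall b, 0 < sigma b)
    (a1 a2 : R -> R) (ha : forall b, 0 < a1 b /\ a1 b <= a2 b)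
    (Delta Delta1 : R) (hDelta : 0 < Delta < 1) (hDelta1 : 0 < Delta1)
    (hscales : forall (k : 'I_K) (b a : R), 0 < a ->
       `|mu - a * derive1 (phi k) b| < Delta -> a1 b <= a <= a2 b)
    (Ups : R -> R) (Upslk : 'I_K -> 'I_K -> R -> R)
    (hUps_ge : forall (l k : 'I_K) (b : R), k != l -> Upslk l k b <= Ups b)
    (hUps : forall (k : 'I_K) (b : R),
       (ereal_sup [set (comp_size phi mu sigma g k b p)%:E | p in
          scale_domain a1 a2 b `\`
          \bigcup_(j in [set: 'I_K]) zone phi mu Delta Delta1 j b]
        <= (Ups b)%:E)%E)
    (hUpslk : forall (l k : 'I_K) (b : R), k != l ->
       (ereal_sup [set (comp_size phi mu sigma g k b p)%:E | p in
          scale_domain a1 a2 b `&` zone phi mu Delta Delta1 l b]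
        <= (Upslk l k b)%:E)%E)
    (hsep : forall k l : 'I_K, k != l ->
       (forall t : R, Delta <= `|derive1 (phi k) t - derive1 (phi l) t| /
                        (derive1 (phi k) t + derive1 (phi l) t)) \/
       (forall t : R, 2 * Delta1 <= `|derive1n 2 (phi k) t - derive1n 2 (phi l) t|))
    (hbound : forall b : R,
       (2%:E * (amp_sum A b)%:E * ((Ups b)%:E + Pi0 eps1 eps3 g sigma a2 b)
        <= amp_min A b)%E)
    (epst : R -> R) (hepst : forall b, 0 < epst b)
    (hepst_ge : forall b : R,
       ((amp_sum A b)%:E * ((Ups b)%:E + Pi0 eps1 eps3 g sigma a2 b)
        <= (epst b)%:E)%E)
    (hepst_le : forall b : R,
       ((epst b)%:E <= amp_min A b -
          (amp_sum A b)%:E * ((Ups b)%:E + Pi0 eps1 eps3 g sigma a2 b))%E) :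
  forall b : R,
    Hset mu sigma a1 a2 g (signal A phi) epst b =
      \bigcup_(k in [set: 'I_K])
        Hcomp phi mu Delta Delta1 sigma a1 a2 g (signal A phi) epst b k /\
    (forall k k' : 'I_K, k != k' ->
       Hcomp phi mu Delta Delta1 sigma a1 a2 g (signal A phi) epst b k `&`
       Hcomp phi mu Delta Delta1 sigma a1 a2 g (signal A phi) epst b k' = set0) /\
    (forall k : 'I_K,
       Hcomp phi mu Delta Delta1 sigma a1 a2 g (signal A phi) epst b k !=set0).
Proof.
move=> b.
have gI : cintegrable g by apply: cLfun1_integrable; case: hg.
have g1 : cintegral g = 1 by have [_ [_ [_ []]]] := hg.
have A0 k : 0 < A k b by have [_ [+ _]] := hx k; exact.
have dphi0 k : 0 < derive1 (phi k) b.
  have [_ [_ [_ [+ _]]]] := hx k; rewrite -lte_fin => /lt_le_trans; apply.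
  by apply: ereal_inf_lbound; exists b.
have [a10 a12] := ha b.
have a20 : 0 < a2 b by exact: lt_le_trans a12.
have M0 : 0 < amp_sum A b.
  rewrite /amp_sum (bigD1 (Ordinal hK))//= ltr_pwDl// sumr_ge0// => j _.
  exact: ltW.
(* The threshold is finite and dominates a positive multiple of Pi0. *)
have Pi0_lty : (Pi0 eps1 eps3 g sigma a2 b < +oo)%E.
  have := hepst_ge b; rewrite ltey; apply: contraTneq => ->.
  by rewrite addey// gt0_muley ?lte_fin// leye_eq.
have [m1 m3] : (abs_moment g 1 < +oo)%E /\ (abs_moment g 3 < +oo)%E.
  have [c3 s3 a3] : [/\ 0 < pi / 3 * eps3, 0 < sigma b ^+ 3 & 0 < a2 b ^+ 3].
    by rewrite !mulr_gt0 ?pi_gt0 ?exprn_gt0.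
  have nonneg n (c s a : R) : 0 < c -> 0 < s -> 0 < a ->
      (0 <= c%:E * abs_moment g n * s%:E * a%:E)%E.
    by move=> c0 s0 a0; rewrite !mule_ge0 ?lee_fin ?abs_moment_ge0// ltW.
  split; rewrite ltey; apply/eqP => mE; move: Pi0_lty; rewrite /Pi0 mE.
  - rewrite gt0_muley ?lte_fin// gt0_mulye ?lte_fin// gt0_mulye ?lte_fin//.
    by rewrite addye// gt_eqF// (lt_le_trans _ (nonneg _ _ _ _ c3 s3 a3))// ltNyr.
  - rewrite gt0_muley ?lte_fin// gt0_mulye ?lte_fin// gt0_mulye ?lte_fin//.
    by rewrite addey// gt_eqF// (lt_le_trans _ (nonneg _ _ _ _ heps1 (hsigma b) a20))// ltNyr.
have Pi0E := Pi0_scale_error eps1 eps3 g m1 m3 sigma b a2.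
set err := scale_error eps1 eps3 g sigma b in Pi0E.
have err_le a : a1 b <= a <= a2 b -> err a <= err (a2 b).
  move=> /andP[a1a aa2]; apply: scale_error_le => //.
  exact: ltW (lt_le_trans a10 a1a).
have eps_ge : amp_sum A b * (Ups b + err (a2 b)) <= epst b.
  by rewrite -lee_fin EFinM EFinD -Pi0E.
have eps_le k : epst b <= A k b - amp_sum A b * (Ups b + err (a2 b)).
  rewrite -lee_fin EFinB EFinM EFinD -Pi0E (le_trans (hepst_le b))// leeB//.
  exact: bigmin_le.
have small_notin (p : R * R) : scale_domain a1 a2 b p ->
    (forall j, comp_size phi mu sigma g j b p <= Ups b) ->
    modulus (tscr mu sigma g (signal A phi) p.1 b p.2) <= epst b.
  move=> pd small; apply: le_trans eps_ge.
  have p0 : 0 < p.1 by case/andP: pd => + _; exact: lt_le_trans.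
  apply: le_trans
    (tscr_upper _ _ _ _ _ hx _ gI m1 m3 _ _ _ (hsigma b) _ _ p0 small) _.
  by rewrite ler_pM2l// lerD2l err_le.
have cross (l j : 'I_K) p : j != l -> scale_domain a1 a2 b p ->
    zone phi mu Delta Delta1 l b p -> comp_size phi mu sigma g j b p <= Ups b.
  move=> jl pd pz; apply: le_trans (hUps_ge l j b jl).
  by rewrite -lee_fin (le_trans _ (hUpslk l j b jl))//; apply: ereal_sup_ubound; exists p.
have outside (j : 'I_K) p : scale_domain a1 a2 b p ->
    (forall l, ~ zone phi mu Delta Delta1 l b p) ->
    comp_size phi mu sigma g j b p <= Ups b.
  move=> pd pz; rewrite -lee_fin (le_trans _ (hUps j b))//.
  by apply: ereal_sup_ubound; exists p => //; split => // -[l _]; exact: pz.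
(* A chirp rate at distance at least Delta1 from every phi_k'' lies outside all
   zones, where Ups bounds a modulus. *)
have Ups0 : 0 <= Ups b.
  pose lam := \sum_(k < K) `|derive1n 2 (phi k) b| + Delta1.
  apply: le_trans (modulus_ge0 _) (outside (Ordinal hK) (a1 b, lam) _ _).
    by rewrite /scale_domain /= lexx.
  move=> l [_ /=]; rewrite ltNge => /negP; apply.
  rewrite (le_trans _ (ler_norm _))// lerBrDr addrC lerD2r.
  by rewrite (bigD1 l)// (le_trans (ler_norm _))// lerDl sumr_ge0.
split; [|split].
- apply/seteqP; split => [p [pd pH]|p [k _ []]//].
  apply: contrapT => pz.
  have : modulus (tscr mu sigma g (signal A phi) p.1 b p.2) <= epst b.
    apply: small_notin => // j; apply: outside => // l pl.
    by apply: pz; exists l.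
  by rewrite leNgt pH.
- (* In an overlap of two zones every component is off resonance with respect to
     one of them, so all of them are small there. *)
  move=> k k' kk'; rewrite -subset0 => p [[[pd pH] pk] [_ pk']].
  have : modulus (tscr mu sigma g (signal A phi) p.1 b p.2) <= epst b.
    apply: small_notin => // j; have [jk|jk] := eqVneq j k.
      by apply: (cross k') => //; rewrite jk.
    exact: (cross k).
  by rewrite leNgt pH.
- move=> k; pose p := (mu / derive1 (phi k) b, derive1n 2 (phi k) b).
  have [D0 D1] := andP hDelta.
  have p0 : 0 < p.1 by rewrite divr_gt0.
  have pE : mu - p.1 * derive1 (phi k) b = 0.
    by rewrite /p /= divfK ?subrr// gt_eqF.
  have pz : zone phi mu Delta Delta1 k b p.
    by split; [rewrite pE normr0|rewrite subrr normr0].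
  have pd : scale_domain a1 a2 b p by apply: (hscales k) => //; case: pz.
  (* The zone is open in the scale, so admitted scales extend beyond p.1. *)
  have p_lt : p.1 < a2 b.
    pose d := Delta / 2 / derive1 (phi k) b.
    have d0 : 0 < d by rewrite !divr_gt0.
    have : a1 b <= p.1 + d <= a2 b.
      apply: (hscales k); first by rewrite addr_gt0.
      rewrite mulrDl opprD addrA pE sub0r normrN /d divfK ?gt_eqF//.
      by rewrite gtr0_norm; lra.
    by case/andP => _; apply: lt_le_trans; rewrite ltrDl.
  have one : comp_size phi mu sigma g k b p = 1.
    rewrite /comp_size pE subrr !mulr0 /poly_fourier.
    rewrite (_ : (fun t => _) = g) ?g1 ?Normc.normc1//.
    apply/funext => t.
    by rewrite !mulr0 !mul0r oppr0 addr0 expi0 mulr1.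
  exists p; split => //; split => //.
  apply: le_lt_trans (eps_le k) _.
  apply: lt_le_trans
    (tscr_lower _ _ _ _ _ hx _ gI m1 m3 _ _ _ (hsigma b) _ _ _ p0 Ups0 one _).
    rewrite ltrD2l ltrN2 ltr_pM2l// ltrD2l.
    apply: scale_error_lt => //; [exact: abs_moment1_gt0|exact: ltW].
  by move=> j jk; exact: (cross k).
Qed.
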